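(* Every finite graph $G$ has a canonical tree-decomposition $(\mathcal T,\mathcal V)$ that efficiently distinguishes all its distinguishable tangles and robust blocks. That is: let $\mathcal P'$ be the set consisting of all $k$-tangles in $G$ (for all integers $k\ge 1$) and all profiles $P_k(b)$ where $k\ge 1$ and $b$ is a $k$-block of $G$ that is robust; then for every two distinguishable elements $P,P'$ of $\mathcal P'$ there is an edge of $\mathcal T$ whose associated separation of $G$ efficiently distinguishes $P$ from $P'$.
   Context: Let $G=(V,E)$ be a finite graph. A separation of $G$ is a set $\{A,B\}$ with $A\cup B=V$ such that $G$ has no edge between $A\setminus B$ and $B\setminus A$; its orientations are $(A,B)$ and $(B,A)$, and its order is $|A\cap B|$. Oriented separations are partially ordered by $(A,B)\le(C,D)$ iff $A\subseteq C$ and $B\supseteq D$; put $(A,B)^*=(B,A)$, $(A,B)\wedge(C,D)=(A\cap C,B\cup D)$, $(A,B)\vee(C,D)=(A\cup C,B\cap D)$. For an integer $k\ge 1$ let $S_k$ be the set of separations of $G$ of order $<k$ and $\vec S_k$ the set of their orientations. An orientation of $S_k$ is a set $O\subseteq\vec S_k$ containing exactly one of $(A,B),(B,A)$ for every $\{A,B\}\in S_k$ (containing $(A,B)$ if $A=B$). It is consistent if there are no two distinct separations $r,s\in S_k$ with orientations $\vec r<\vec s$ such that $\vec r^{\,*},\vec s\in O$. A $k$-profile is a consistent orientation $P$ of $S_k$ such that for all $\vec r,\vec s\in P$ the separation $(\vec r\vee\vec s)^*$ is not in $P$. A $k$-profile $P$ is robust if for every $\vec r\in P$ and every separation $s$ of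 $G$ (of any order), with orientations $\vec s,\vec s^{\,*}$: if $\vec r^{\,*}\wedge\vec s$ and $\vec r^{\,*}\wedge\vec s^{\,*}$ both have order less than the order of $\vec r$, then they do not both lie in $P$. A $k$-tangle (tangle of order $k$) in $G$ is an orientation $\theta$ of $S_k$ such that $G[A_1]\cup G[A_2]\cup G[A_3]\neq G$ for all (not necessarily distinct) $(A_1,B_1),(A_2,B_2),(A_3,B_3)\in\theta$. A $k$-block of $G$ is a maximal set $b$ of at least $k$ vertices such that no two vertices $x,y\in b$ can be separated in $G$ by fewer than $k$ vertices other than $x$ and $y$. It induces the $k$-profile $P_k(b)=\{(A,B)\in\vec S_k: b\subseteq B\}$. A block (a $k$-block for some $k$) $b$ is robust if all the profiles $P_k(b)$ it induces (for all $k$ for which $b$ is a $k$-block) are robust. A separation $\{A,B\}$ with $A\ne B$ distinguishes two profiles $P,P'$ (possibly a $k$-profile and a $k'$-profile with $k\neq k'$) if it has one orientation in $P$ and the inverse orientation in $P'$. Tangles are profiles, and distinguishing a block means distinguishing the profiles it induces. $P,P'$ are distinguishable if some separation of $G$ distinguishes them; a separation distinguishes them efficiently if it has the smallest order among all separations of $G$ that distinguish them. For a tree-decomposition $(\mathcal T,\mathcal V)$ with $\mathcal V=(V_t)_{t\in\mathcal T}$, the separation associated with an edge $e=t_1t_2$ of $\mathcal T$ is $\{\bigcup_{t\in T_1}V_t,\bigcup_{t\in T_2}V_t\}$, where $T_i$ is the component of $\mathcal T-e$ containing $t_i$. The tree-decomposition is canonical if the automorphisms of $G$ act naturally on $\mathcal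 T$: they map every part $V_t$ to a part $V_{t'}$ in such a way that $t\mapsto t'$ is an automorphism of $\mathcal T$ (i.e. the automorphism group of $G$ acts on $\mathcal T$ by automorphisms $t\mapsto\alpha(t)$ with $\alpha(V_t)=V_{\alpha(t)}$). *)

(* Defs.v *)
From mathcomp Require Import all_boot all_fingroup.
Set Implicit Arguments.
Unset Strict Implicit.
Unset Printing Implicit Defensive.

(* A graph is a symmetric irreflexive [e : rel V] on a finite
   vertex type [V]. *)

(* An oriented separation (A, B) is a pair of vertex sets.  An unoriented
   separation {A, B} is given by either of its orientations; every notion below
   that concerns unoriented separations is invariant under [sep_inv]. *)
Definition osep (V : finType) : Type := ({set V} * {set V})%type.

Section Separations.
Variables (V : finType) (e : rel V).
Implicit Types (r s : osep V) (P O : {set osep V}) (b : {set V}).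

Definition is_sep s : bool :=
  (s.1 :|: s.2 == setT) &&
  [forall x in s.1 :\: s.2, forall y in s.2 :\: s.1, ~~ e x y].

Definition sep_inv s : osep V := (s.2, s.1).
Definition sep_order s : nat := #|s.1 :&: s.2|.
Definition sep_le r s : bool := (r.1 \subset s.1) && (s.2 \subset r.2).
Definition sep_lt r s : bool := (r != s) && sep_le r s.
Definition sep_meet r s : osep V := (r.1 :&: s.1, r.2 :|: s.2).
Definition sep_join r s : osep V := (r.1 :|: s.1, r.2 :&: s.2).

Definition seps (k : nat) : {set osep V} :=
  [set s | is_sep s & sep_order s < k].

(* Counting in the set {s, s^*} also covers s = s^*, where s must be in O. *)
Definition orientation (k : nat) O : Prop :=
  O \subset seps k /\
  forall s, s \in seps k -> #|O :&: [set s; sep_inv s]| = 1.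

(* [r != sep_inv s] together with [sep_lt r s] says that the unoriented
   separations are distinct. *)
Definition consistent (k : nat) O : Prop :=
  forall r s, r \in seps k -> s \in seps k -> r != sep_inv s -> sep_lt r s ->
    ~ (sep_inv r \in O /\ s \in O).

Definition profile (k : nat) P : Prop :=
  [/\ orientation k P, consistent k P &
      forall r s, r \in P -> s \in P -> sep_inv (sep_join r s) \notin P].

Definition robust P : Prop :=
  forall r s, r \in P -> is_sep s ->
    sep_order (sep_meet (sep_inv r) s) < sep_order r ->
    sep_order (sep_meet (sep_inv r) (sep_inv s)) < sep_order r ->
    ~ (sep_meet (sep_inv r) s \in P /\
       sep_meet (sep_inv r) (sep_inv s) \in P).

(* The edges of G[A], each listed in both directions. *)
Definition edges_in (A : {set V}) : {set V * V} :=
  [set p in setX A A | e p.1 p.2].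

(* Subgraphs are given as pairs (vertex set, edge set). *)
Definition induced (A : {set V}) : {set V} * {set V * V} := (A, edges_in A).
Definition graph_union (H K : {set V} * {set V * V}) :
  {set V} * {set V * V} := (H.1 :|: K.1, H.2 :|: K.2).

Definition tangle (k : nat) O : Prop :=
  orientation k O /\
  forall r s t, r \in O -> s \in O -> t \in O ->
    graph_union (graph_union (induced r.1) (induced s.1)) (induced t.1)
    <> induced setT.

Definition separates (X : {set V}) (x y : V) : bool :=
  [&& x \notin X, y \notin X &
      ~~ connect [rel u v | [&& e u v, u \notin X & v \notin X]] x y].

Definition inseparable (k : nat) b : bool :=
  [forall x in b, forall y in b, (x != y) ==>
     ~~ [exists X : {set V}, (#|X| < k) && separates X x y]].

Definition is_block (k : nat) b : bool :=
  maxset (fun c : {set V} => (k <= #|c|) && inseparable k c) b.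

Definition block_profile (k : nat) b : {set osep V} :=
  [set s in seps k | b \subset s.2].

Definition robust_block b : Prop :=
  forall k, 0 < k -> is_block k b -> robust (block_profile k b).

Definition tangle_or_robust_block P : Prop :=
  (exists2 k, 0 < k & tangle k P) \/
  (exists k b, [/\ 0 < k, is_block k b, robust_block b &
                   P = block_profile k b]).

Definition distinguishes s P P' : Prop :=
  [/\ is_sep s, s.1 != s.2 &
      (s \in P /\ sep_inv s \in P') \/ (sep_inv s \in P /\ s \in P')].

Definition distinguishable P P' : Prop := exists s, distinguishes s P P'.

Definition efficiently_distinguishes s P P' : Prop :=
  distinguishes s P P' /\
  forall s', distinguishes s' P P' -> sep_order s <= sep_order s'.

Definition graph_aut : {set {perm V}} :=
  [set a : {perm V} | [forall x, forall y, e (a x) (a y) == e x y]].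

Lemma sep_noedge s x y : is_sep s -> e x y ->
  x \in s.1 -> x \notin s.2 -> y \in s.2 -> y \notin s.1 -> False.
Proof.
case/andP=> _ /'forall_in_'forall_in_negP nE exy x1 x2 y2 y1.
by apply: (nE x _ y); rewrite ?inE ?x1 ?y2 ?(negbTE x2) ?(negbTE y1).
Qed.

Lemma sep_cover s x : is_sep s -> (x \in s.1) || (x \in s.2).
Proof. by case/andP=> /eqP/setP/(_ x); rewrite !inE. Qed.

Lemma induced_cover (A B C : {set V}) :
  (forall x, [|| x \in A, x \in B | x \in C]) ->
  (forall x y, e x y -> [|| (x \in A) && (y \in A), (x \in B) && (y \in B)
                         | (x \in C) && (y \in C)]) ->
  graph_union (graph_union (induced A) (induced B)) (induced C) = induced setT.
Proof.
move=> cV cE; congr pair; apply/setP.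
  by move=> x; rewrite !inE -orbA cV.
case=> x y; rewrite !inE /=; case exy: (e x y); last by rewrite !andbF.
by have := cE _ _ exy; rewrite !andbT orbA.
Qed.

Hypothesis e_sym : symmetric e.

Lemma sep_edge s x y : is_sep s -> e x y ->
  ((x \in s.1) && (y \in s.1)) || ((x \in s.2) && (y \in s.2)).
Proof.
move=> ss exy; have cx := sep_cover x ss; have cy := sep_cover y ss.
have n1 := sep_noedge ss exy.
have eyx : e y x by rewrite e_sym.
have n2 := sep_noedge ss eyx.
move: cx cy n1 n2.
by case: (x \in s.1); case: (x \in s.2); case: (y \in s.1); case: (y \in s.2)
  => //= _ _ n1 n2; try (by case: n1); try (by case: n2).
Qed.

Lemma tangle_profile (k : nat) O : tangle k O -> profile k O.
Proof.
case=> oO tO; have sO r : r \in O -> is_sep r.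
  by case: oO => /subsetP sub _ /sub; rewrite inE => /andP[].
split=> //.
  move=> r s _ _ _ /andP[_ /andP[/subsetP rs _]] [rO sO'].
  have sr := sO _ rO.
  apply: (tO _ _ _ rO sO' sO'); apply: induced_cover => [x|x y exy] /=.
    by have := sep_cover x sr => /= /orP[->|/rs->]; rewrite ?orbT.
  have := sep_edge sr exy => /= /orP[->//|/andP[/rs-> /rs->]].
  by rewrite orbT.
move=> r s rO sO'; apply/negP => jO.
have sr := sO _ rO; have ss := sO _ sO'.
apply: (tO _ _ _ rO sO' jO); apply: induced_cover => [x|x y exy] /=.
  have := sep_cover x sr; have := sep_cover x ss; rewrite !inE.
  by case: (x \in r.1); case: (x \in s.1) => //= -> ->.
have := sep_edge sr exy; have := sep_edge ss exy; rewrite !inE.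
by case/orP=> [->|/andP[-> ->]]; rewrite ?orbT // => /orP[->|/andP[-> ->]];
  rewrite ?orbT.
Qed.

Lemma separates_sep s x y : is_sep s ->
  x \in s.1 -> x \notin s.2 -> y \in s.2 -> y \notin s.1 ->
  separates (s.1 :&: s.2) x y.
Proof.
move=> ss x1 x2 y2 y1; rewrite /separates !inE x1 (negbTE x2) (negbTE y1) /=.
apply/negP => /connectP[p]; elim: p x x1 x2 => [|z p IH] x x1 x2 /=.
  by move=> _ yx; move: y1; rewrite yx x1.
rewrite !inE => /andP[/and3P[exz _ nz] pz] yE.
have z1 : z \in s.1.
  by have := sep_edge ss exz; rewrite x1 (negbTE x2) orbF.
by apply: IH pz yE => //; move: nz; rewrite z1.
Qed.

Lemma block_profile_profile (k : nat) b :
  is_block k b -> profile k (block_profile k b).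
Proof.
case/maxsetP=> /andP[kb /'forall_in_forall_inP ins] _.
have small s : sep_order s < k -> b \subset s.1 -> b \subset s.2 -> False.
  move=> sk b1 b2; have: b \subset s.1 :&: s.2 by rewrite subsetI b1.
  by move/subset_leq_card => bs; have := leq_trans sk kb; rewrite ltnNge bs.
have side s : s \in seps k -> (b \subset s.1) || (b \subset s.2).
  rewrite inE => /andP[ss sk]; case: (boolP (b \subset s.2)) => [|nb2].
    by rewrite orbT.
  rewrite orbF; case/subsetPn: nb2 => x xb x2; apply/subsetP => y yb.
  apply/negPn/negP => y1.
  have x1 : x \in s.1 by have := sep_cover x ss; rewrite (negbTE x2) orbF.
  have y2 : y \in s.2 by have := sep_cover y ss; rewrite (negbTE y1).
  have nxy : x != y by apply: contraNneq x2 => ->.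
  have /implyP/(_ nxy)/existsP[] := ins x xb y yb.
  by exists (s.1 :&: s.2); rewrite [_ < k]sk separates_sep.
have inv s : s \in seps k -> sep_inv s \in seps k.
  rewrite !inE /sep_order /= setIC => /andP[/andP[/eqP c /forall_inP n] ->].
  rewrite andbT; apply/andP; split=> /=; first by rewrite setUC c.
  apply/forall_inP => x xs; apply/forall_inP => y ys.
  by rewrite e_sym; have /forall_inP := n y ys; apply.
split.
- split; first by apply/subsetP => s; rewrite inE => /andP[].
  move=> s sS; have iS := inv s sS.
  have sk : sep_order s < k by move: sS; rewrite inE => /andP[].
  have /orP[bs|bs] := side s sS.
    rewrite (_ : _ :&: _ = [set sep_inv s]) ?cards1 //; apply/setP => t.
    rewrite in_setI in_set2 in_set1; case: eqP => [->|_] /=; last first.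
      by case: eqP => [->|]; rewrite ?andbF // inE iS /= bs.
    rewrite inE sS /=; case: eqP => [->|_]; first by rewrite /= bs.
    by apply/negP; rewrite andbT => /(small s sk bs).
  rewrite (_ : _ :&: _ = [set s]) ?cards1 //; apply/setP => t.
  rewrite in_setI in_set2 in_set1; case: eqP => [->|_] /=.
    by rewrite inE sS bs.
  case: eqP => [->|_]; rewrite ?andbF // inE iS /= andbT.
  by apply/negP => bs1; apply: (small s sk).
- move=> r s _ sS _ /andP[_ /andP[rs _]] []; rewrite !inE.
  move=> /andP[_ /= br] /andP[/andP[_ sk] bs].
  exact: (small s sk (subset_trans br rs) bs).
- move=> r s; rewrite !inE => /andP[_ br] /andP[_ bs].
  apply/negP => /andP[/andP[_ jk] bj].
  by apply: (small _ jk _ bj); rewrite /= subsetI br.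
Qed.

End Separations.

Definition is_tree (T : finType) (f : rel T) : Prop :=
  [/\ symmetric f, irreflexive f, 0 < #|T|,
      forall t u, connect f t u &
      forall c : seq T, ucycle f c -> size c <= 2].

Definition is_tree_decomposition (V : finType) (e : rel V)
    (T : finType) (f : rel T) (W : T -> {set V}) : Prop :=
  [/\ is_tree f,
      \bigcup_t W t = setT,
      forall x y, e x y -> exists2 t, x \in W t & y \in W t &
      (* t :: p is the path from t to last t p in the tree *)
      forall t p u, path f t p -> uniq (t :: p) -> u \in t :: p ->
        W t :&: W (last t p) \subset W u].

(* Automorphisms compose left to right in [{perm V}], so a left action of the
   automorphism group is a right action in the sense of [action]. *)
Definition is_canonical (V : finType) (e : rel V)
    (T : finType) (f : rel T) (W : T -> {set V}) : Prop :=
  exists to : action (graph_aut e) T,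
    forall a, a \in graph_aut e ->
      (forall t u, f (to t a) (to u a) = f t u) /\
      (forall t, a @: W t = W (to t a)).

Definition delete_edge (T : finType) (f : rel T) (t1 t2 : T) : rel T :=
  [rel t u | f t u && ([set t; u] != [set t1; t2])].

Definition edge_sep (V T : finType) (f : rel T) (W : T -> {set V})
    (t1 t2 : T) : osep V :=
  (\bigcup_(t | connect (delete_edge f t1 t2) t1 t) W t,
   \bigcup_(t | connect (delete_edge f t1 t2) t2 t) W t).

(* Main.v *)
Require Import Defs.
From mathcomp Require Import all_boot all_fingroup.
From mathcomp Require Import boolp zify.

(** The profiles induced by tangles and robust blocks are robust, and they are
regular: they never contain a separation [(A, B)] with [A] the whole vertex
set.  Robust regular profiles are all that the proof needs, and as their
definition does not mention tangles or blocks, the symmetries of the graph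
carry over to them directly.

For two distinguishable profiles, consider the separations distinguishing them
efficiently.  Crossing separations can be replaced by their corners.  If [r]
and [s] cross, everything nested with both is nested with their corner
[r \/ s] ([nested_corner]), opposite corners together cross fewer separations
than [r] and [s] do ([crossing_corners]), and their orders together are at most
those of [r] and [s] ([sep_order_corners]).  Whether a corner still
distinguishes the profiles is answered by the profile axioms, in two ways.

- If [r] efficiently distinguishes some profiles, and [s], of greater order,
  efficiently distinguishes [P] from [P'], then some corner of [r] and
  [s] again efficiently distinguishes [P] from [P'] ([lower_order_corner]);
  this is where robustness enters.
- If [r] and [s] have the same order, two opposite corners can take their
  places, one each, unless [r] and [s] both distinguish both pairs of profiles,
  when both corners can take the place of [s].  So if [r] and [s] were chosen
  to cross as few separations as possible, they are nested ([optimal_nested]).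

Choosing distinguishers order by order, and taking at each order all those that
are nested with the earlier choices and subject to this cross as few
separations as possible, therefore gives a nested set [tree_set] containing an
efficient distinguisher for every distinguishable pair.  No arbitrary choice
was made, so the automorphisms of the graph preserve this set
([tree_set_map]).

A nested set [N] of separations none of which lies below its own inverse is the
edge set of a tree.  Its nodes are the down-closed orientations of [N], two of
them being adjacent if they differ in one separation; the part of a node is the
intersection of the sides it points to.  Every [s] in [N] is a maximal element
of exactly one node, [edge_head], and the edge between the nodes pointed to by
[s] and by its inverse is the only one across which the orientation of [s]
changes.  Connectedness, acyclicity, the tree-decomposition axioms and the
identification of the separations associated with the edges all follow from
this. *)

Set Implicit Arguments.
Unset Strict Implicit.
Unset Printing Implicit Defensive.

(** * Nested separations and corners *)
Section Nested.
Variable V : finType.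
Implicit Types r s t c : osep V.

Lemma sep_invK : involutive (@sep_inv V).
Proof. by case. Qed.

Lemma sep_order_inv s : sep_order (sep_inv s) = sep_order s.
Proof. by rewrite /sep_order setIC. Qed.

Lemma sep_joinC r s : sep_join r s = sep_join s r.
Proof. by rewrite /sep_join setUC setIC. Qed.

Lemma sep_le_refl s : sep_le s s.
Proof. by rewrite /sep_le !subxx. Qed.

Lemma sep_le_trans s r t : sep_le r s -> sep_le s t -> sep_le r t.
Proof.
move=> /andP[rs sr] /andP[st ts].
by rewrite /sep_le (subset_trans rs st) (subset_trans ts sr).
Qed.

Lemma sep_le_anti r s : sep_le r s -> sep_le s r -> r = s.
Proof.
case: r s => [A B] [C D] /andP[/= AC DB] /andP[/= CA BD].
by congr pair; apply/eqP; rewrite eqEsubset ?AC ?BD.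
Qed.

Lemma sep_le_inv r s : sep_le (sep_inv r) (sep_inv s) = sep_le s r.
Proof. by rewrite /sep_le andbC. Qed.

Lemma sep_le_invl r s : sep_le (sep_inv r) s = sep_le (sep_inv s) r.
Proof. by rewrite -sep_le_inv sep_invK. Qed.

Lemma sep_le_invr r s : sep_le r (sep_inv s) = sep_le s (sep_inv r).
Proof. by rewrite -sep_le_inv sep_invK. Qed.

Lemma sep_le_joinl r s : sep_le r (sep_join r s).
Proof. by rewrite /sep_le subsetUl subsetIl. Qed.

Lemma sep_le_joinr r s : sep_le s (sep_join r s).
Proof. by rewrite /sep_le subsetUr subsetIr. Qed.

Lemma sep_join_le r s t : sep_le r t -> sep_le s t -> sep_le (sep_join r s) t.
Proof.
by move=> /andP[rt tr] /andP[st ts]; rewrite /sep_le subUset rt st subsetI tr.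
Qed.

Definition nested r s :=
  [|| sep_le r s, sep_le s r, sep_le r (sep_inv s) | sep_le (sep_inv s) r].

Lemma nestedC r s : nested r s = nested s r.
Proof.
rewrite /nested (sep_le_invr r) (sep_le_invl s).
by case: (sep_le r s); case: (sep_le s r).
Qed.

Lemma nested_invr r s : nested r (sep_inv s) = nested r s.
Proof.
rewrite /nested sep_invK.
by do 4 case: (sep_le _ _).
Qed.

Lemma nested_invl r s : nested (sep_inv r) s = nested r s.
Proof. by rewrite nestedC nested_invr nestedC. Qed.

Lemma nested_join r s : nested r (sep_join r s).
Proof. by rewrite /nested sep_le_joinl. Qed.

(** If one of the comparabilities of [t] with [r] and with [s] puts [t] or its
inverse below [r] or [s], it persists for the join.  Otherwise [r] and [s] both
lie below [t] or its inverse: below the same one, so does the join; below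
opposite ones, [r] and [s] would be comparable through [t]. *)
Lemma nested_corner r s t :
  ~~ nested r s -> nested t r -> nested t s -> nested t (sep_join r s).
Proof.
have jl := sep_le_joinl r s; have jr := sep_le_joinr r s.
have below u : sep_le u (sep_join r s) -> sep_le t u -> nested t (sep_join r s).
  by move=> uj tu; apply/or4P; constructor 1; apply: sep_le_trans tu uj.
have above u : sep_le u (sep_join r s) -> sep_le (sep_inv u) t ->
    nested t (sep_join r s).
  move=> uj ut; apply/or4P; constructor 4.
  by apply: sep_le_trans ut; rewrite sep_le_inv.
move=> crs /or4P[/(below _ jl)|rt|tr|/(above _ jl)] //.
all: case/or4P=> [/(below _ jr)|st|ts|/(above _ jr)] //.
- by apply/or4P; constructor 2; apply: sep_join_le.
- case/negP: crs; apply/or4P; constructor 3; exact: sep_le_trans rt ts.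
- case/negP: crs; rewrite nestedC; apply/or4P; constructor 3.
  exact: sep_le_trans st tr.
by apply/or4P; constructor 3; rewrite sep_le_invr sep_join_le // sep_le_invr.
Qed.

Lemma nested_opposite_corners r s t : nested t r ->
  nested t (sep_join r s) || nested t (sep_join (sep_inv r) (sep_inv s)).
Proof.
have jl := sep_le_joinl r s.
have jl' := sep_le_joinl (sep_inv r) (sep_inv s).
case/or4P=> [tr|rt|tr|rt]; apply/orP.
- by left; apply/or4P; constructor 1; apply: sep_le_trans tr jl.
- right; apply/or4P; constructor 4; rewrite sep_le_invl.
  by apply: sep_le_trans jl'; rewrite sep_le_inv.
- by right; apply/or4P; constructor 1; apply: sep_le_trans tr jl'.
left; apply/or4P; constructor 4; apply: sep_le_trans rt.
by rewrite sep_le_inv.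
Qed.

(** All pairs of vertex sets are counted, not only separations of the graph:
this leaves the uncrossing argument purely order-theoretic and makes the
counts obviously invariant under permutations of the vertices. *)
Definition crossing s : {set osep V} := [set t | ~~ nested t s].

Lemma crossing_inv s : crossing (sep_inv s) = crossing s.
Proof. by apply/setP => t; rewrite !inE nested_invr. Qed.

(** Submodularity in counting form, used both for orders and for numbers of
crossing separations. *)
Lemma leq_card_UI (T : finType) (A B C D : {set T}) :
  A :|: B \subset C :|: D -> A :&: B \subset C :&: D ->
  #|A| + #|B| <= #|C| + #|D|.
Proof.
by move=> U I; rewrite -(cardsUI A) -(cardsUI C) leq_add ?subset_leq_card.
Qed.

(** A separation crossing a corner crosses [r] or [s], and one crossing both
opposite corners crosses both [r] and [s].  The inequality is strict because
[r] crosses [s] but neither corner. *)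
Lemma crossing_corners r s : ~~ nested r s ->
  #|crossing (sep_join r s)| + #|crossing (sep_join (sep_inv r) (sep_inv s))|
  < #|crossing r| + #|crossing s|.
Proof.
move=> crs; have cinv : ~~ nested (sep_inv r) (sep_inv s).
  by rewrite nested_invl nested_invr.
rewrite -(cardsUI (crossing (sep_join r s))) -(cardsUI (crossing r)).
rewrite -addSn leq_add //.
  apply: proper_card; apply/properP; split.
    apply/subsetP => t; rewrite !inE -!negb_and; apply: contra => /andP[tr ts].
    by apply/andP; split; apply: nested_corner; rewrite // nested_invr.
  exists r; first by rewrite !inE crs orbT.
  by rewrite !inE nested_join -(nested_invl r) nested_join.
apply/subset_leq_card/subsetP => t; rewrite !inE -!negb_or; apply: contra.
case/orP=> [tr|ts]; first exact: nested_opposite_corners.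
by rewrite sep_joinC (sep_joinC (sep_inv r)) nested_opposite_corners.
Qed.

Lemma sep_order_corners r s :
  sep_order (sep_join r s) + sep_order (sep_join (sep_inv r) (sep_inv s))
  <= sep_order r + sep_order s.
Proof.
apply: leq_card_UI; apply/subsetP => x; rewrite !inE /=;
by do 4 case: (x \in _).
Qed.

End Nested.

(** * Robust regular profiles *)
Section Profiles.
Variables (V : finType) (e : rel V).
Hypothesis e_sym : symmetric e.
Implicit Types (r s t c : osep V) (P Q : {set osep V}).

Lemma is_sep_inv s : is_sep e s -> is_sep e (sep_inv s).
Proof.
case/andP=> /= /eqP c /forall_inP n; rewrite /is_sep /= setUC c eqxx /=.
apply/forall_inP => x xs; apply/forall_inP => y ys.
by rewrite e_sym; have /forall_inP := n y ys; apply.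
Qed.

Lemma is_sep_join r s : is_sep e r -> is_sep e s -> is_sep e (sep_join r s).
Proof.
move=> sr ss; apply/andP; split=> /=.
  apply/eqP/setP => x; have := sep_cover x sr; have := sep_cover x ss.
  by rewrite !inE; do 4 case: (x \in _).
apply/forall_inP => x; rewrite !inE => /andP[xBD _].
apply/forall_inP => y; rewrite !inE negb_or => /andP[/andP[yA yC] /andP[yB yD]].
apply/negP => exy.
case/nandP: xBD => xn.
  have xA : x \in r.1 by have := sep_cover x sr; rewrite (negPf xn) orbF.
  exact: (sep_noedge sr exy xA xn yB yA).
have xC : x \in s.1 by have := sep_cover x ss; rewrite (negPf xn) orbF.
exact: (sep_noedge ss exy xC xn yD yC).
Qed.

(** Regularity turns consistency into genuine down-closure ([profile_down])
and, later, keeps separations lying below their own inverse out of the nested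
set ([tree_set_proper]). *)
Definition regular_profile P : Prop :=
  [/\ exists k, profile e k P, robust e P & forall s, s \in P -> s.1 != setT].

(** For a tangle containing [r] and both corners in the definition of
robustness, the first sides of these three separations would cover the
graph. *)
Lemma tangle_or_robust_block_regular P :
  tangle_or_robust_block e P -> regular_profile P.
Proof.
case=> [[k _ tP]|[k [b [k0 bl rb ->]]]].
  have pP := tangle_profile e_sym tP; have [[/subsetP sub _] tri] := tP.
  have sP s : s \in P -> is_sep e s by move/sub; rewrite inE => /andP[].
  split; first by exists k.
    move=> r s rP ss _ _ [m1 m2]; apply: (tri _ _ _ rP m1 m2).
    have sr := sP _ rP; apply: induced_cover => [x|x y exy] /=.
      have := sep_cover x sr; have := sep_cover x ss; rewrite !inE.
      by do 4 case: (x \in _).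
    have := sep_edge e_sym sr exy; have := sep_edge e_sym ss exy; rewrite !inE.
    by do 4 case: (x \in _); do 4 case: (y \in _).
  move=> s sP'; apply/eqP => s1; apply: (tri s s s sP' sP' sP').
  by rewrite s1 /graph_union /induced /= !setUid.
split; [by exists k; exact: block_profile_profile | exact: rb |].
move=> s; rewrite !inE => /andP[/andP[_ sk] bs]; apply/eqP => s1.
case/maxsetP: bl => /andP[kb _] _; move: sk.
by rewrite /sep_order s1 setTI ltnNge (leq_trans kb (subset_leq_card bs)).
Qed.

Section OneProfile.
Variable P : {set osep V}.
Hypothesis rP : regular_profile P.

Lemma profile_is_sep s : s \in P -> is_sep e s.
Proof.
by case: rP => [[k [[/subsetP sub _] _ _]] _ _] /sub; rewrite inE => /andP[].
Qed.

(** A reference element [s] replaces the parameter [k] of the profile: whatever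
has order at most that of [s] is oriented. *)
Lemma profile_orients s r : s \in P -> is_sep e r ->
  sep_order r <= sep_order s -> (r \in P) || (sep_inv r \in P).
Proof.
case: rP => [[k [[/subsetP sub or] _ _]] _ _] sP sr rs.
have rk : r \in seps e k.
  rewrite inE sr (leq_ltn_trans rs) //.
  by have := sub _ sP; rewrite inE => /andP[].
have /eqP/cards1P[t /setP/(_ t)] := or r rk.
by rewrite !inE eqxx => /andP[tP /orP[] /eqP <-]; rewrite tP ?orbT.
Qed.

Lemma profile_joinP s r t : s \in P -> r \in P -> t \in P ->
  sep_order (sep_join r t) <= sep_order s -> sep_join r t \in P.
Proof.
move=> sP rP' tP le.
have sj := is_sep_join (profile_is_sep rP') (profile_is_sep tP).
case/orP: (profile_orients sP sj le) => // jP.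
by case: rP => [[k [_ _ /(_ _ _ rP' tP)]]]; rewrite jP.
Qed.

Lemma profile_not_both s : s \in P -> sep_inv s \notin P.
Proof.
move=> sP; apply/negP => isP; have ss := profile_is_sep sP.
(* The join of [s] with its inverse has the order of [s] and full first side. *)
have T : (sep_join s (sep_inv s)).1 = setT by case/andP: ss => /= /eqP.
have := profile_joinP sP sP isP; rewrite /sep_order T setTI /= setIC => /(_ _).
case: rP => _ _ reg jP.
by have := reg _ (jP (leqnn _)); rewrite T eqxx.
Qed.

(** Consistency says nothing when [t] is the inverse of [s]; regularity excludes
this case. *)
Lemma profile_down s t : s \in P -> is_sep e t -> sep_le t s ->
  sep_order t <= sep_order s -> t \in P.
Proof.
move=> sP st ts le; case/orP: (profile_orients sP st le) => // itP.
case: (eqVneq t s) => [->//|nts].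
case: rP => [[k [[/subsetP sub or] cons _]] _ reg].
have sk := sub _ sP.
have tk : t \in seps e k.
  by rewrite inE st (leq_ltn_trans le) //; move: sk; rewrite inE => /andP[].
case: (eqVneq t (sep_inv s)) => [E|nti].
  case/andP: ts; rewrite E /= => s21 _.
  have := reg _ sP; have /andP[/eqP] := profile_is_sep sP.
  by rewrite (setUidPl s21) => ->; rewrite eqxx.
by case: (cons t s tk sk nti); rewrite /sep_lt ?nts ?ts.
Qed.

End OneProfile.

End Profiles.

(** * Corners that distinguish profiles *)
Section Corners.
Variables (V : finType) (e : rel V).
Hypothesis e_sym : symmetric e.
Implicit Types (r s t c : osep V) (P Q : {set osep V}).

Local Notation eff := (efficiently_distinguishes e).

Definition splits s P P' : Prop := s \in P /\ sep_inv s \in P'.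

Lemma splits_inv s P P' : splits s P P' -> splits (sep_inv s) P' P.
Proof. by case=> sP sP'; split; rewrite ?sep_invK. Qed.

Lemma distinguishes_inv s P P' :
  distinguishes e s P P' -> distinguishes e (sep_inv s) P P'.
Proof.
case=> ss ne d; split; first exact: is_sep_inv.
  by rewrite eq_sym.
by rewrite sep_invK; tauto.
Qed.

Lemma distinguishesC s P P' : distinguishes e s P P' -> distinguishes e s P' P.
Proof. by case=> ss ne d; split=> //; tauto. Qed.

Lemma efficient_inv s P P' : eff s P P' -> eff (sep_inv s) P P'.
Proof.
by case=> d m; split=> [|s' /m]; rewrite ?sep_order_inv //;
  apply: distinguishes_inv.
Qed.

Lemma efficientC s P P' : eff s P P' -> eff s P' P.
Proof.
by case=> d m; split=> [|s' /distinguishesC/m//]; apply: distinguishesC.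
Qed.

Lemma distinguishes_splits s P P' :
  distinguishes e s P P' -> splits s P P' \/ splits s P' P.
Proof. by case=> _ _ [[]|[]]; [left|right]. Qed.

Lemma efficient_smaller s c P P' : eff s P P' -> distinguishes e c P P' ->
  sep_order c <= sep_order s -> eff c P P'.
Proof. by case=> _ m dc le; split=> // s' /m; apply: leq_trans. Qed.

Lemma efficient_exists P P' : distinguishable e P P' -> exists s, eff s P P'.
Proof.
case=> s ds; case: (@arg_minnP _ s (fun t => `[< distinguishes e t P P' >])
  (@sep_order V)); first exact/asboolP.
move=> t /asboolP dt m; exists t; split=> // s' ds'; apply: m; exact/asboolP.
Qed.

Section TwoProfiles.
Variables P P' : {set osep V}.
Hypotheses (rP : regular_profile e P) (rP' : regular_profile e P').

Lemma splits_distinguishes s : splits s P P' -> distinguishes e s P P'.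
Proof.
move=> [sP sP']; split; [exact: profile_is_sep sP | | by left].
move: (profile_not_both rP sP); apply: contraNneq => s12.
by case: s s12 sP sP' => A B /= ->.
Qed.

(** The basic transfer to corners: joining with an element [r] of [P] keeps
the join in [P], by the profile property, and its inverse in [P'], by
consistency. *)
Lemma join_splits r s : r \in P -> splits s P P' ->
  sep_order (sep_join r s) <= sep_order s -> splits (sep_join r s) P P'.
Proof.
move=> rP1 [sP sP'] le; split; first exact: (profile_joinP rP sP).
apply: (profile_down rP' sP'); rewrite ?sep_order_inv //.
  apply/is_sep_inv => //.
  by apply: is_sep_join; apply: (profile_is_sep rP).
by rewrite sep_le_inv sep_le_joinr.
Qed.

End TwoProfiles.

(** The meet [r /\ s] is the inverse of the corner opposite to [r \/ s]. *)
Lemma sep_order_join_le r s : sep_order r <= sep_order (sep_meet r s) ->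
  sep_order (sep_join r s) <= sep_order s.
Proof.
move=> le; rewrite -(leq_add2r (sep_order r)) (addnC (sep_order s)).
apply: leq_trans (sep_order_corners r s); rewrite leq_add2l.
by rewrite -(sep_order_inv (sep_join _ _)).
Qed.

(** Were both meets of smaller order than [r], then [Q], containing [r], would
contain both, and by robustness [Q'] would contain the inverse of one of them.
That one would distinguish [Q] from [Q'] more efficiently than [r]. *)
Lemma robust_corner Q Q' r s : regular_profile e Q -> regular_profile e Q' ->
  eff r Q Q' -> splits r Q Q' -> is_sep e s ->
  (sep_order r <= sep_order (sep_meet r s)) ||
  (sep_order r <= sep_order (sep_meet r (sep_inv s))).
Proof.
move=> rQ rQ' [_ eff_r] [rinQ rinQ'] ss; have sr := profile_is_sep rQ rinQ.
apply: contraT; rewrite negb_or -!ltnNge => /andP[lt1 lt2].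
have inQ' t : is_sep e t -> sep_order (sep_meet r t) < sep_order r ->
    sep_meet r t \in Q'.
  move=> st lt.
  have sm : is_sep e (sep_meet r t).
    (* By computation, [r /\ t] is the inverse of [r^* \/ t^*]. *)
    exact: (is_sep_inv e_sym
      (is_sep_join (is_sep_inv e_sym sr) (is_sep_inv e_sym st))).
  have mQ : sep_meet r t \in Q.
    apply: (profile_down rQ rinQ sm _ (ltnW lt)).
    by rewrite /sep_le subsetIl subsetUl.
  have := profile_orients rQ' rinQ' sm; rewrite sep_order_inv => /(_ (ltnW lt)).
  case/orP=> // mQ'; suff /eff_r : distinguishes e (sep_meet r t) Q Q'.
    by rewrite leqNgt lt.
  exact: splits_distinguishes.
have [_ rob _] := rQ'; case: (rob _ s rinQ' ss); rewrite ?sep_order_inv //.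
by split; apply: inQ' => //; apply: is_sep_inv.
Qed.

(** As [s] is efficient, [P] and [P'] orient the lower-order [r] alike, say both
contain [r].  Then [r \/ s] or [r \/ s^*], whichever [robust_corner] shows to
have order at most that of [s], distinguishes [P] from [P']. *)
Lemma lower_order_corner P P' Q Q' r s :
  regular_profile e P -> regular_profile e P' ->
  regular_profile e Q -> regular_profile e Q' ->
  eff r Q Q' -> eff s P P' -> sep_order r < sep_order s -> ~~ nested r s ->
  exists c, [/\ eff c P P', nested r c &
                forall t, nested t r -> nested t s -> nested t c].
Proof.
move=> rP rP' rQ rQ' er es lt crs.
wlog sp : P P' rP rP' es / splits s P P' => [W|].
  have [es1 _] := es; case: (distinguishes_splits es1) => sp.
    exact: (W P P').
  have [c [ec nc fc]] := W P' P rP' rP (efficientC es) sp.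
  by exists c; split=> //; apply: efficientC.
have [sP sP'] := sp; have ss := profile_is_sep rP sP.
have sr : is_sep e r by case: er => [[]].
wlog rinP : r er lt crs sr / r \in P => [W|].
  case/orP: (profile_orients rP sP sr (ltnW lt)); first exact: (W r).
  move=> /(W _ (efficient_inv er)).
  rewrite sep_order_inv nested_invl => /(_ lt crs (is_sep_inv e_sym sr)).
  case=> c [ec nc fc]; exists c; split=> //; first by rewrite nested_invl in nc.
  by move=> t; rewrite -(nested_invr t r); apply: fc.
have rinP' : r \in P'.
  have := profile_orients rP' sP' sr; rewrite sep_order_inv => /(_ (ltnW lt)).
  case/orP=> // rinP'; have [_ /(_ r)] := es.
  by rewrite leqNgt lt => /(_ (splits_distinguishes rP (conj rinP rinP'))).
wlog spr : Q Q' rQ rQ' er / splits r Q Q' => [W|].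
  have [er1 _] := er; case: (distinguishes_splits er1) => spr.
    exact: (W Q Q').
  exact: (W Q' Q rQ' rQ (efficientC er) spr).
case/orP: (robust_corner rQ rQ' er spr ss) => le.
  exists (sep_join r s); split; [|exact: nested_join|].
    have lej := sep_order_join_le le.
    by apply: (efficient_smaller es) => //; apply/splits_distinguishes/join_splits.
  by move=> t tr ts; apply: nested_corner.
exists (sep_join r (sep_inv s)); split; [|exact: nested_join|].
  have lej := sep_order_join_le le.
  apply: (efficient_smaller es); last by rewrite -(sep_order_inv s).
  apply/distinguishesC/splits_distinguishes => //.
  by apply: join_splits => //; apply: splits_inv.
by move=> t tr ts; apply: nested_corner; rewrite ?nested_invr.
Qed.

End Corners.

(** * Distinguishers of equal order *)
Section Optimal.
Variables (V : finType) (e : rel V).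
Hypothesis e_sym : symmetric e.
Implicit Types (r s t c : osep V) (P Q M : {set osep V}).

Local Notation eff := (efficiently_distinguishes e).
Local Notation reg := (regular_profile e).

Definition nested_to M s := [forall t in M, nested t s].

Lemma nested_toP M s : reflect (forall t, t \in M -> nested t s) (nested_to M s).
Proof. exact: forall_inP. Qed.

Lemma nested_to_inv M s : nested_to M (sep_inv s) = nested_to M s.
Proof. by apply: eq_forallb_in => t _; rewrite nested_invr. Qed.

Lemma nested_to_join M r s : ~~ nested r s ->
  nested_to M r -> nested_to M s -> nested_to M (sep_join r s).
Proof.
move=> crs /nested_toP nr /nested_toP ns; apply/nested_toP => t tM.
by apply: nested_corner; [|exact: nr|exact: ns].
Qed.

Definition optimal M P P' s : Prop :=
  [/\ eff s P P', nested_to M s & forall c, eff c P P' -> nested_to M c ->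
      #|crossing s| <= #|crossing c|].

Lemma optimal_inv M P P' s : optimal M P P' s -> optimal M P P' (sep_inv s).
Proof.
case=> es ns ms; split; [exact: efficient_inv | by rewrite nested_to_inv |].
by rewrite crossing_inv.
Qed.

Lemma optimalC M P P' s : optimal M P P' s -> optimal M P' P s.
Proof.
by case=> es ns ms; split=> // [|c /efficientC]; [exact: efficientC | exact: ms].
Qed.

Lemma optimal_exists M P P' s : eff s P P' -> nested_to M s ->
  exists t, optimal M P P' t.
Proof.
move=> es ns; case: (@arg_minnP _ s
    (fun t => `[< eff t P P' >] && nested_to M t) (fun t => #|crossing t|)).
  by rewrite ns andbT; apply/asboolP.
move=> t /andP[/asboolP et nt] m; exists t; split=> // c ec nc; apply: m.
by rewrite nc andbT; apply/asboolP.
Qed.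

(** If one of the corners had too large an order, the other one would by
submodularity have too small an order to distinguish its pair of profiles. *)
Lemma efficient_opposite_corners P P' Q Q' r s c c' :
  eff r Q Q' -> eff s P P' -> sep_order r = sep_order s ->
  sep_order c + sep_order c' <= sep_order r + sep_order s ->
  (sep_order c <= sep_order s -> distinguishes e c P P') ->
  (sep_order c' <= sep_order r -> distinguishes e c' Q Q') ->
  eff c P P' /\ eff c' Q Q'.
Proof.
move=> er es rs le dc dc'; have [_ mr] := er; have [_ ms] := es.
have lec : sep_order c <= sep_order s.
  by case: leqP dc' => // lt /(_ _)/mr; lia.
have lec' : sep_order c' <= sep_order r.
  by case: leqP dc => // lt /(_ _)/ms; lia.
by split; [apply: (efficient_smaller es)|apply: (efficient_smaller er)]; auto.
Qed.

(** By [crossing_corners], one of the two corners would cross fewer separations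
than the distinguisher that it can replace. *)
Lemma optimal_no_corners M P P' Q Q' r s :
  optimal M Q Q' r -> optimal M P P' s -> ~~ nested r s ->
  eff (sep_join r s) P P' -> eff (sep_join (sep_inv r) (sep_inv s)) Q Q' ->
  False.
Proof.
move=> [_ nr mr] [_ ns ms] crs /ms m1 /mr m2.
have := crossing_corners crs.
have := m1 (nested_to_join crs nr ns).
suff /m2 : nested_to M (sep_join (sep_inv r) (sep_inv s)) by lia.
by apply: nested_to_join; rewrite ?nested_to_inv // nested_invl nested_invr.
Qed.

(** Here [r] and [s] each distinguish only one of the pairs, and the corners
[r \/ s^*] and [r^* \/ s] replace [s] and [r] respectively. *)
Lemma optimal_nested_agree M P P' Q Q' r s :
  reg P -> reg P' -> reg Q -> reg Q' ->
  optimal M Q Q' r -> optimal M P P' s -> sep_order r = sep_order s ->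
  r \in P -> r \in P' -> s \in Q -> s \in Q' -> nested r s.
Proof.
move=> rP rP' rQ rQ' or os rs rinP rinP' sinQ sinQ'.
wlog sp : P P' rP rP' os rinP rinP' / splits s P P' => [W|].
  have [[es1 _] _ _] := os; case: (distinguishes_splits es1) => sp.
    exact: (W P P').
  exact: (W P' P rP' rP (optimalC os)).
wlog spr : Q Q' rQ rQ' or sinQ sinQ' / splits r Q Q' => [W|].
  have [[er1 _] _ _] := or; case: (distinguishes_splits er1) => spr.
    exact: (W Q Q').
  exact: (W Q' Q rQ' rQ (optimalC or)).
apply: contraT => crs; have [er _ _] := or; have [es _ _] := os.
have crs' : ~~ nested r (sep_inv s) by rewrite nested_invr.
have [|||ec ec'] := efficient_opposite_corners (c := sep_join r (sep_inv s))
  (c' := sep_join (sep_inv r) (sep_inv (sep_inv s))) er es rs.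
- by rewrite -(sep_order_inv s) sep_order_corners.
- rewrite -(sep_order_inv s) => le; apply/distinguishesC/splits_distinguishes => //.
  by apply: join_splits => //; apply: splits_inv.
- rewrite -(sep_order_inv r) sep_invK sep_joinC => le.
  apply/distinguishesC/splits_distinguishes => //.
  by apply: join_splits => //; apply: splits_inv.
by case: (optimal_no_corners or (optimal_inv os) crs' ec ec').
Qed.

(** Now [r] distinguishes [P] from [P'] as well, so both [r \/ s] and
[r^* \/ s^*] can replace [s].  Say [Q] contains [r].  If [Q] contains [s], or
if [Q'] contains [s^*], one of these two corners can also replace [r].
Otherwise [s] distinguishes [Q] from [Q'] too; then [r] and [s] have equally
many crossings and one of the two corners has fewer. *)
Lemma optimal_nested_split M P P' Q Q' r s :
  reg P -> reg P' -> reg Q -> reg Q' ->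
  optimal M Q Q' r -> optimal M P P' s -> sep_order r = sep_order s ->
  splits r P P' -> splits s P P' -> nested r s.
Proof.
move=> rP rP' rQ rQ' or os rs rspl sspl.
have [[er1 _] _ _] := or.
wlog spr : Q Q' rQ rQ' or er1 / splits r Q Q' => [W|].
  case: (distinguishes_splits er1) => spr; first exact: (W Q Q').
  exact: (W Q' Q rQ' rQ (optimalC or) (distinguishesC er1)).
apply: contraT => crs; have [er nr mr] := or; have [es ns ms] := os.
have dP : sep_order (sep_join r s) <= sep_order s ->
    distinguishes e (sep_join r s) P P'.
  by move=> le; apply/splits_distinguishes/join_splits => //; case: rspl.
have dP' : sep_order (sep_join (sep_inv r) (sep_inv s)) <= sep_order s ->
    distinguishes e (sep_join (sep_inv r) (sep_inv s)) P P'.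
  rewrite -(sep_order_inv s) => le.
  apply/distinguishesC/splits_distinguishes => //.
  by apply: join_splits => //; [case: rspl | apply: splits_inv].
have ss : is_sep e s by case: es => [[]].
have [rQin rQ'in] := spr.
have le := sep_order_corners r s.
have le' := le; rewrite addnC in le'.
have := profile_orients rQ rQin ss; rewrite rs => /(_ (leqnn _)) /orP[sQ|sQ].
  have [|ec ec'] := efficient_opposite_corners er es rs le' dP'.
    rewrite sep_joinC => le1; apply/splits_distinguishes => //.
    exact: join_splits.
  case: (optimal_no_corners (optimal_inv or) (optimal_inv os)) => //.
  by rewrite nested_invr nested_invl.
have := profile_orients rQ' rQ'in ss.
rewrite sep_order_inv rs => /(_ (leqnn _)) /orP[sQ'|sQ']; last first.
  have [|ec ec'] := efficient_opposite_corners er es rs le dP.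
    rewrite sep_joinC -(sep_order_inv r) => le1.
    apply/distinguishesC/splits_distinguishes => //.
    by apply: join_splits => //; apply: splits_inv.
  by case: (optimal_no_corners or os).
have es' : eff s Q Q'.
  apply: (efficient_smaller er); rewrite ?rs //.
  apply/distinguishesC/splits_distinguishes => //.
have er' : eff r P P'.
  by apply: (efficient_smaller es); rewrite ?rs //; apply/splits_distinguishes.
rewrite -rs in dP'.
have [ec ec'] := efficient_opposite_corners er' es rs le dP dP'.
have := crossing_corners crs; have := mr _ es' ns.
have := ms _ ec (nested_to_join crs nr ns).
suff /(ms _ ec') : nested_to M (sep_join (sep_inv r) (sep_inv s)) by lia.
by apply: nested_to_join; rewrite ?nested_to_inv // nested_invl nested_invr.
Qed.

(** Up to inverting [r] or [s] and exchanging their roles, the two preceding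
lemmas cover all ways in which [P] and [P'] can orient [r], and [Q] and [Q']
can orient [s]. *)
Lemma optimal_nested M P P' Q Q' r s :
  reg P -> reg P' -> reg Q -> reg Q' ->
  optimal M Q Q' r -> optimal M P P' s -> sep_order r = sep_order s ->
  nested r s.
Proof.
have split2 P1 P1' Q1 Q1' r1 s1 : reg P1 -> reg P1' -> reg Q1 -> reg Q1' ->
    optimal M Q1 Q1' r1 -> optimal M P1 P1' s1 -> sep_order r1 = sep_order s1 ->
    splits r1 P1 P1' -> nested r1 s1.
  move=> rP rP' rQ rQ' or os rs spr; have [[ds _] _ _] := os.
  case: (distinguishes_splits ds) => sps.
    exact: (optimal_nested_split rP rP' rQ rQ' or os).
  rewrite -nested_invr.
  apply: (optimal_nested_split rP rP' rQ rQ' or (optimal_inv os)) => //.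
    by rewrite sep_order_inv.
  exact: splits_inv.
move=> rP rP' rQ rQ' or os rs.
have [[dr _] _ _] := or; have [[ds _] _ _] := os.
have [sr _ _] := dr; have [ss _ _] := ds.
have orient P1 P2 s1 r1 : reg P1 -> reg P2 -> distinguishes e s1 P1 P2 ->
    is_sep e r1 -> sep_order r1 = sep_order s1 ->
    ((r1 \in P1) || (sep_inv r1 \in P1)) /\ ((r1 \in P2) || (sep_inv r1 \in P2)).
  move=> rP1 rP2 [_ _ d] sr1 E; split.
    case: d => [[h _]|[h _]]; apply: (profile_orients rP1 h sr1);
      by rewrite ?sep_order_inv E.
  case: d => [[_ h]|[_ h]]; apply: (profile_orients rP2 h sr1);
    by rewrite ?sep_order_inv E.
have [rp rp'] := orient P P' s r rP rP' ds sr rs.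
have [sq sq'] := orient Q Q' r s rQ rQ' dr ss (esym rs).
case/orP: rp => rp; case/orP: rp' => rp'.
- case/orP: sq => sq; case/orP: sq' => sq'.
  + exact: (optimal_nested_agree rP rP' rQ rQ' or os).
  + rewrite nestedC; exact: (split2 Q Q' P P').
  + rewrite nestedC; apply: (split2 Q' Q P P') => //; exact: optimalC.
  + rewrite -nested_invr.
    apply: (optimal_nested_agree rP rP' rQ rQ' or (optimal_inv os)) => //.
    by rewrite sep_order_inv.
- exact: (split2 P P' Q Q').
- by apply: (split2 P' P Q Q') => //; exact: optimalC.
- case/orP: sq => sq; case/orP: sq' => sq'.
  + rewrite -nested_invl.
    apply: (optimal_nested_agree rP rP' rQ rQ' (optimal_inv or) os) => //.
    by rewrite sep_order_inv.
  + rewrite nestedC; exact: (split2 Q Q' P P').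
  + rewrite nestedC; apply: (split2 Q' Q P P') => //; exact: optimalC.
  + rewrite -nested_invr -nested_invl.
    apply: (optimal_nested_agree rP rP' rQ rQ' (optimal_inv or)
      (optimal_inv os)) => //.
    by rewrite !sep_order_inv.
Qed.

End Optimal.

(** * The nested set of distinguishers *)
Section TreeSet.
Variables (V : finType) (e : rel V).
Hypothesis e_sym : symmetric e.
Implicit Types (r s t c : osep V) (P Q M : {set osep V}).

Local Notation eff := (efficiently_distinguishes e).
Local Notation reg := (regular_profile e).

Definition optimal_seps M k : {set osep V} :=
  [set s | `[< sep_order s = k /\
               exists P P', [/\ reg P, reg P' & optimal e M P P' s] >]].

(** All optimal separations for all pairs are added at once, since a choice
among them would destroy canonicity. *)
Fixpoint tree_set k : {set osep V} :=
  if k is k'.+1 then tree_set k' :|: optimal_seps (tree_set k') k' else set0.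

Lemma optimal_sepsP M k s :
  reflect (sep_order s = k /\
           exists P P', [/\ reg P, reg P' & optimal e M P P' s])
          (s \in optimal_seps M k).
Proof. by rewrite inE; apply: asboolP. Qed.

Lemma tree_set_inv k s : s \in tree_set k -> sep_inv s \in tree_set k.
Proof.
elim: k => [|k IH] /=; first by rewrite inE.
rewrite !(in_setU s, in_setU (sep_inv s)) => /orP[/IH->//|].
case/optimal_sepsP=> ord [P [P' [rP rP' os]]]; apply/orP; right.
apply/optimal_sepsP; rewrite sep_order_inv; split=> //.
by exists P, P'; split=> //; apply: optimal_inv.
Qed.

Lemma tree_set_efficient k s : s \in tree_set k ->
  sep_order s < k /\ exists P P', [/\ reg P, reg P' & eff s P P'].
Proof.
elim: k => [|k IH] /=; first by rewrite inE.
rewrite in_setU => /orP[/IH[lt ex]|]; first by split=> //; apply: ltnW.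
case/optimal_sepsP=> -> [P [P' [rP rP' [es _ _]]]].
by split=> //; exists P, P'.
Qed.

(** Separations of different orders are nested by construction, those of
equal order by [optimal_nested]. *)
Lemma tree_set_nested k r s : r \in tree_set k -> s \in tree_set k -> nested r s.
Proof.
elim: k => [|k IH] /=; first by rewrite inE.
rewrite !(in_setU r, in_setU s) => /orP[rM|rO] /orP[sM|sO]; first exact: IH.
- by case/optimal_sepsP: sO => _ [P [P' [_ _ [_ /nested_toP n _]]]]; apply: n.
- rewrite nestedC.
  by case/optimal_sepsP: rO => _ [P [P' [_ _ [_ /nested_toP n _]]]]; apply: n.
case/optimal_sepsP: rO => ro [Q [Q' [rQ rQ' or]]].
case/optimal_sepsP: sO => so [P [P' [rP rP' os]]].
by apply: (optimal_nested e_sym rP rP' rQ rQ' or os); rewrite ro so.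
Qed.

Lemma subset_tree_set k l : k <= l -> tree_set k \subset tree_set l.
Proof.
elim: l => [|l IH]; first by rewrite leqn0 => /eqP->.
rewrite leq_eqVlt => /orP[/eqP->//|/IH sub].
exact: (subset_trans sub (subsetUl _ _)).
Qed.

(** An efficient distinguisher [t] with fewest crossings in the earlier choices
[M] has none.  For if [r] in [M] crosses [t], the corner from
[lower_order_corner] crosses no element of [M] that [t] does not cross, and
does not cross [r]. *)
Lemma efficient_nested_exists P P' s : reg P -> reg P' -> eff s P P' ->
  exists2 t, eff t P P' & nested_to (tree_set (sep_order s)) t.
Proof.
move=> rP rP' es; set M := tree_set _.
case: (@arg_minnP _ s (fun t => `[< eff t P P' >])
    (fun t => #|M :&: crossing t|)); first exact/asboolP.
move=> t /asboolP et min; exists t => //; apply/nested_toP => r rM.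
apply: contraT => crt; have [lt [Q [Q' [rQ rQ' er]]]] := tree_set_efficient rM.
have st : sep_order s = sep_order t.
  by have [ds ms] := es; have [dt mt] := et; apply/eqP; rewrite eqn_leq ms ?mt.
have [c [ec nrc fc]] : exists c, [/\ eff c P P', nested r c &
    forall u, nested u r -> nested u t -> nested u c].
  by apply: (lower_order_corner e_sym rP rP' rQ rQ' er et); rewrite // -st.
have /min : `[< eff c P P' >] by apply/asboolP.
rewrite leqNgt proper_card //; apply/properP; split; last first.
  by exists r; rewrite !inE rM //= nrc.
apply/subsetP => u; rewrite !inE => /andP[uM]; rewrite uM; apply: contra.
by apply: fc; apply: tree_set_nested uM rM.
Qed.

Lemma tree_set_distinguishes P P' : reg P -> reg P' -> distinguishable e P P' ->
  exists2 s, s \in tree_set #|V|.+1 & eff s P P'.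
Proof.
move=> rP rP' /efficient_exists[s es].
have [t et nt] := efficient_nested_exists rP rP' es.
have [u ou] := optimal_exists et nt; have [eu _ _] := ou.
exists u => //; apply: (subsetP (subset_tree_set (_ : (sep_order s).+1 <= _))).
  by rewrite ltnS max_card.
rewrite inE; apply/orP; right; apply/optimal_sepsP; split; last by exists P, P'.
by have [ds ms] := es; have [du mu] := eu; apply/eqP; rewrite eqn_leq ms ?mu.
Qed.

Lemma tree_set_is_sep k s : s \in tree_set k -> is_sep e s.
Proof. by case/tree_set_efficient=> _ [P [P' [_ _ [[]]]]]. Qed.

(** If [s] lay below its inverse, the first side of the inverse would be the
whole vertex set; but the inverse belongs to one of the two regular profiles
that [s] distinguishes. *)
Lemma tree_set_proper k s : s \in tree_set k -> ~~ sep_le s (sep_inv s).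
Proof.
move=> sN; have ss := tree_set_is_sep sN.
apply/negP => /andP[/= s12 _].
have [_ [P [P' [rP rP' [ds _]]]]] := tree_set_efficient sN.
have [_ _ d] := ds.
have s2 : s.2 = setT by case/andP: ss => /eqP <- _; rewrite (setUidPr s12).
case: d => [[_ d]|[d _]].
  by case: rP' => _ _ /(_ _ d); rewrite /= s2 eqxx.
by case: rP => _ _ /(_ _ d); rewrite /= s2 eqxx.
Qed.

End TreeSet.

(** * Invariance under automorphisms *)
Section Automorphisms.
Local Open Scope group_scope.
Variables (V : finType) (e : rel V).
Implicit Types (r s t c : osep V) (P Q M : {set osep V}) (a b : {perm V}).

Definition sep_map a s : osep V := (a @: s.1, a @: s.2).

Lemma sep_mapM a b s : sep_map (a * b) s = sep_map b (sep_map a s).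
Proof.
by rewrite /sep_map /= -!imset_comp; congr pair; apply: eq_imset => x;
  rewrite /= permM.
Qed.

Lemma sep_map1 s : sep_map 1 s = s.
Proof.
case: s => A B; rewrite /sep_map /=.
by congr pair; rewrite -[RHS]imset_id; apply: eq_imset => x; rewrite perm1.
Qed.

Lemma sep_mapK a : cancel (sep_map a) (sep_map a^-1).
Proof. by move=> s; rewrite -sep_mapM mulgV sep_map1. Qed.

Lemma sep_mapKV a : cancel (sep_map a^-1) (sep_map a).
Proof. by move=> s; rewrite -sep_mapM mulVg sep_map1. Qed.

Lemma sep_map_inj a : injective (sep_map a).
Proof. exact: can_inj (sep_mapK a). Qed.

Lemma sep_mapP a s : exists t, s = sep_map a t.
Proof. by exists (sep_map a^-1 s); rewrite sep_mapKV. Qed.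

Lemma sep_map_inv a s : sep_map a (sep_inv s) = sep_inv (sep_map a s).
Proof. by []. Qed.

Lemma sep_map_join a r s :
  sep_map a (sep_join r s) = sep_join (sep_map a r) (sep_map a s).
Proof.
by rewrite /sep_map /sep_join /= imsetU imsetI //; move=> x y _ _; apply: perm_inj.
Qed.

Lemma sep_map_order a s : sep_order (sep_map a s) = sep_order s.
Proof.
rewrite /sep_order /= -imsetI; last by move=> x y _ _; apply: perm_inj.
exact/card_imset/perm_inj.
Qed.

Lemma imset_perm_sub a (A B : {set V}) : (a @: A \subset a @: B) = (A \subset B).
Proof.
apply/idP/idP=> [/subsetP sub|]; last exact: imsetS.
by apply/subsetP => x xA; rewrite -(mem_imset _ _ (@perm_inj _ a)) sub ?imset_f.
Qed.

Lemma sep_map_le a r s : sep_le (sep_map a r) (sep_map a s) = sep_le r s.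
Proof. by rewrite /sep_le !imset_perm_sub. Qed.

Lemma sep_map_nested a r s : nested (sep_map a r) (sep_map a s) = nested r s.
Proof. by rewrite /nested -!sep_map_inv !sep_map_le. Qed.

Lemma sep_map_crossing a s : #|crossing (sep_map a s)| = #|crossing s|.
Proof.
rewrite -[RHS](card_imset _ (@sep_map_inj a)); congr #|pred_of_set _|.
apply/setP => t; have [u ->] := sep_mapP a t.
by rewrite mem_imset ?inE ?sep_map_nested //; apply: sep_map_inj.
Qed.

Lemma graph_autV a : a \in graph_aut e -> a^-1 \in graph_aut e.
Proof.
rewrite !inE => /'forall_forallP h; apply/'forall_forallP => x y.
by have := h (a^-1 x) (a^-1 y); rewrite !permKV eq_sym.
Qed.

Lemma sep_map_is_sep a s : a \in graph_aut e ->
  is_sep e (sep_map a s) = is_sep e s.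
Proof.
have imp b t : b \in graph_aut e -> is_sep e t -> is_sep e (sep_map b t).
  rewrite inE => /'forall_forallP h st; apply/andP; split=> /=.
    rewrite -imsetU; case/andP: st => /eqP-> _; apply/eqP.
    by apply/setP=> x; rewrite inE -(permKV b x) mem_imset ?inE //; apply: perm_inj.
  apply/forall_inP => x; rewrite inE => /andP[].
  move=> x2 /imsetP[x' x1 E]; move: x2; rewrite {x}E mem_imset; last exact: perm_inj.
  move=> x2; apply/forall_inP => y; rewrite inE => /andP[].
  move=> y1 /imsetP[y' y2 E]; move: y1; rewrite {y}E mem_imset; last exact: perm_inj.
  move=> y1; rewrite (eqP (h x' y')); apply/negP => exy.
  exact: (sep_noedge st exy).
move=> aut; apply/idP/idP; last exact: imp.
by move/(imp _ _ (graph_autV aut)); rewrite sep_mapK.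
Qed.

Lemma sep_map_seps a s k : a \in graph_aut e ->
  (sep_map a s \in seps e k) = (s \in seps e k).
Proof. by move=> aut; rewrite !inE sep_map_is_sep // sep_map_order. Qed.

Lemma mem_sep_map a s P : (sep_map a s \in sep_map a @: P) = (s \in P).
Proof. exact/mem_imset/sep_map_inj. Qed.

Lemma regular_profile_map a P : a \in graph_aut e ->
  regular_profile e P -> regular_profile e (sep_map a @: P).
Proof.
move=> aut [[k [[sub or] cons prof]] rob reg]; split.
- exists k; split; first split.
  + apply/subsetP => s; have [t ->] := sep_mapP a s.
    by rewrite mem_sep_map sep_map_seps //; apply: (subsetP sub).
  + move=> s; have [t ->] := sep_mapP a s; rewrite sep_map_seps // => /or <-.
    rewrite -[RHS](card_imset _ (@sep_map_inj a)) imsetI; last first.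
      by move=> x y _ _; apply: sep_map_inj.
    by rewrite imsetU !imset_set1 sep_map_inv.
  + move=> r s; have [r' ->] := sep_mapP a r; have [s' ->] := sep_mapP a s.
    rewrite -!sep_map_inv !sep_map_seps // !mem_sep_map /sep_lt sep_map_le.
    by rewrite !(inj_eq (@sep_map_inj a)); apply: cons.
  move=> r s; have [r' ->] := sep_mapP a r; have [s' ->] := sep_mapP a s.
  by rewrite -sep_map_join -sep_map_inv !mem_sep_map; apply: prof.
- move=> r s; have [r' ->] := sep_mapP a r; have [s' ->] := sep_mapP a s.
  have meet p q : sep_meet (sep_inv (sep_map a p)) (sep_map a q) =
      sep_map a (sep_meet (sep_inv p) q).
    exact (congr1 (@sep_inv V) (esym (sep_map_join a p (sep_inv q)))).
  rewrite -(sep_map_inv a s') !meet !sep_map_order !mem_sep_map sep_map_is_sep //.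
  exact: rob.
move=> s; have [t ->] := sep_mapP a s; rewrite mem_sep_map => /reg.
apply: contraNneq => /= E; rewrite -(inj_eq (imset_inj (@perm_inj _ a))) E.
by apply/eqP/setP => x; rewrite inE -(permKV a x) mem_imset ?inE //; apply: perm_inj.
Qed.

Lemma distinguishes_map a s P P' : a \in graph_aut e ->
  distinguishes e s P P' ->
  distinguishes e (sep_map a s) (sep_map a @: P) (sep_map a @: P').
Proof.
move=> aut [ss ne d]; split; first by rewrite sep_map_is_sep.
  by rewrite /= (inj_eq (imset_inj (@perm_inj _ a))).
by rewrite -sep_map_inv !mem_sep_map.
Qed.

Lemma imset_sep_mapK a P : sep_map a^-1 @: (sep_map a @: P) = P.
Proof.
rewrite -imset_comp -[RHS]imset_id; apply: eq_imset => s /=; exact: sep_mapK.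
Qed.

Lemma efficient_map a s P P' : a \in graph_aut e ->
  efficiently_distinguishes e s P P' ->
  efficiently_distinguishes e (sep_map a s) (sep_map a @: P) (sep_map a @: P').
Proof.
move=> aut [ds ms]; split=> [|t]; first exact: distinguishes_map.
move/(distinguishes_map (graph_autV aut)); rewrite !imset_sep_mapK => /ms.
by rewrite !sep_map_order.
Qed.

Lemma optimal_map a M P P' s : a \in graph_aut e ->
  (forall t, t \in M -> sep_map a^-1 t \in M) ->
  (forall t, t \in M -> sep_map a t \in M) ->
  optimal e M P P' s ->
  optimal e M (sep_map a @: P) (sep_map a @: P') (sep_map a s).
Proof.
move=> aut MV Ma [es ns ms].
have nested_map b c : (forall t, t \in M -> sep_map b^-1 t \in M) ->
    nested_to M c -> nested_to M (sep_map b c).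
  move=> Mb /nested_toP nc; apply/nested_toP => t tM.
  by rewrite -(sep_mapKV b t) sep_map_nested; apply/nc/Mb.
split; [exact: efficient_map | exact: nested_map |].
move=> c /(efficient_map (graph_autV aut)); rewrite !imset_sep_mapK => ec nc.
rewrite sep_map_crossing -(sep_map_crossing a^-1 c); apply: ms => //.
by apply: nested_map; rewrite // invgK.
Qed.

Lemma tree_set_map k a s : a \in graph_aut e ->
  s \in tree_set e k -> sep_map a s \in tree_set e k.
Proof.
elim: k a s => [|k IH] a s aut /=; first by rewrite inE.
rewrite !(in_setU s, in_setU (sep_map a s)) => /orP[/IH->//|].
case/optimal_sepsP=> ord [P [P' [rP rP' os]]]; apply/orP; right.
apply/optimal_sepsP; rewrite sep_map_order; split=> //.
exists (sep_map a @: P), (sep_map a @: P'); split; try exact: regular_profile_map.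
by apply: optimal_map => // t; apply: IH => //; apply: graph_autV.
Qed.

End Automorphisms.

(** * The tree of a nested set *)
Section Tree.
Variables (V : finType) (N : {set osep V}).
Implicit Types (r s t : osep V) (O : {set osep V}) (K : {set V}).

(** As no element of [N] lies below its inverse, down-closed orientations of
[N] are the same as consistent ones. *)
Definition is_node O : bool :=
  [&& O \subset N,
      [forall s in N, (s \in O) (+) (sep_inv s \in O)] &
      [forall s in O, forall t in N, sep_le t s ==> (t \in O)]].

Definition node : finType := {O : {set osep V} | is_node O}.
Implicit Types x y z u v w : node.

Definition flip s O := sep_inv s |: (O :\ s).
Definition adjacent : rel node :=
  fun x y => [exists s in val x, val y == flip s (val x)].
Definition part x : {set V} := \bigcap_(s in val x) s.2.

(** The node that [s] points to: the only down-closed orientation of [N] in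
which [s] is maximal. *)
Definition head_set s : {set osep V} :=
  [set t in N | sep_le t s || sep_lt t (sep_inv s)].

Lemma node_sub x s : s \in val x -> s \in N.
Proof. by case/and3P: (valP x) => /subsetP sub _ _ /sub. Qed.

Lemma node_inv x s : s \in N -> (sep_inv s \in val x) = (s \notin val x).
Proof.
case/and3P: (valP x) => _ /forall_inP h _ /h.
by case: (s \in _); case: (_ \in _).
Qed.

Lemma node_down x s t : s \in val x -> t \in N -> sep_le t s -> t \in val x.
Proof.
case/and3P: (valP x) => _ _ /forall_inP h /h/forall_inP h' /h'.
by move/implyP.
Qed.

Hypothesis N_inv : forall s, s \in N -> sep_inv s \in N.

(** Nodes contain exactly one of [s] and its inverse for each [s] in [N], so
none is a proper subset of another. *)
Lemma node_subset_eq x y : val x \subset val y -> x = y.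
Proof.
move=> /subsetP sub; apply/val_inj/setP => s; apply/idP/idP; first exact: sub.
move=> sy; have sN := node_sub sy; apply: contraTT sy.
by rewrite -!node_inv // => /sub.
Qed.

(** Going up strictly in the order of separations enlarges the first side or
shrinks the second. *)
Lemma maximal_exists (D : {set osep V}) s0 : s0 \in D ->
  exists2 s, s \in D & forall t, t \in D -> sep_le s t -> t = s.
Proof.
move=> s0D; case: (arg_maxnP (fun s => #|s.1| + #|~: s.2|) s0D) => s sD max.
exists s => // t tD st; have := max t tD; have /andP[s1 s2] := st.
have := subset_leq_card s1; move: s2; rewrite -setCS => /[dup] s2 /subset_leq_card.
move=> c2 c1 le.
have e1 : #|t.1| = #|s.1|.
  apply/eqP; rewrite eqn_leq c1 andbT -(leq_add2r #|~: s.2|).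
  by apply: leq_trans le; rewrite leq_add2l.
have e2 : #|~: t.2| <= #|~: s.2| by rewrite -(leq_add2l #|t.1|) {2}e1.
have E1 : s.1 = t.1 by apply/eqP; rewrite eqEcard s1 e1 /=.
have E2 : s.2 = t.2.
  by apply: setC_inj; apply/eqP; rewrite eqEcard s2.
by case: t s E1 E2 {sD max st s1 s2 c2 c1 le e1 e2 tD} => ? ? [? ?] /= -> ->.
Qed.

Hypothesis N_nested : forall r s, r \in N -> s \in N -> nested r s.
Hypothesis N_proper : forall s, s \in N -> ~~ sep_le s (sep_inv s).

Lemma N_neq_inv s : s \in N -> s != sep_inv s.
Proof. by move/N_proper; apply: contraNneq => {1}->; exact: sep_le_refl. Qed.

Lemma head_set_node s : s \in N -> is_node (head_set s).
Proof.
move=> sN; have pr := N_proper sN.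
have pr' : ~~ sep_le (sep_inv s) s by have := N_proper (N_inv sN); rewrite sep_invK.
apply/and3P; split.
- by apply/subsetP => t; rewrite inE => /andP[].
- apply/forall_inP => t tN.
  suff -> : (sep_inv t \in head_set s) = (t \notin head_set s) by rewrite addbN addbb.
  apply/idP/idP; rewrite !inE tN N_inv //= /sep_lt.
    move=> h; apply/negP => /orP[|/andP[nts]]; case/orP: h.
    + rewrite sep_le_invl => st ts.
      by case/negP: pr'; apply: sep_le_trans st ts.
    + rewrite sep_le_inv => /andP[nts st] ts.
      by case/eqP: nts; rewrite (sep_le_anti ts st).
    + by rewrite sep_le_invl => st ts; case/eqP: nts; apply: sep_le_anti.
    rewrite sep_le_inv => /andP[_ st] ts.
    by case/negP: pr; apply: sep_le_trans st ts.
  rewrite sep_le_inv (inj_eq (inv_inj (@sep_invK V))) sep_le_invl.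
  rewrite negb_or negb_and negbK => /andP[nts].
  case/or4P: (N_nested tN sN) => [ts|st|ts|->] //; first by rewrite ts in nts.
    rewrite st andbT => _; apply/orP; right.
    by apply: contraNneq nts => ->; apply: sep_le_refl.
  by rewrite ts orbF => /eqP->; rewrite sep_le_refl.
apply/forall_inP => t; rewrite inE => /andP[tN h].
apply/forall_inP => u uN; apply/implyP => ut; rewrite inE uN /=.
case/orP: h => [ts|/andP[ne ts]]; first by rewrite (sep_le_trans ut ts).
rewrite /sep_lt (sep_le_trans ut ts) andbT; apply/orP; right.
by apply: contraNneq ne => E; rewrite E in ut; rewrite (sep_le_anti ts ut).
Qed.

Definition edge_head s (sN : s \in N) : node := Sub (head_set s) (head_set_node sN).

Lemma mem_edge_head s (sN : s \in N) : s \in val (edge_head sN).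
Proof. by rewrite inE sN sep_le_refl. Qed.

Lemma notin_edge_head_inv s (sN : s \in N) (sN' : sep_inv s \in N) :
  s \notin val (edge_head sN').
Proof. by rewrite -[s in s \notin _]sep_invK node_inv // negbK mem_edge_head. Qed.

Lemma node_maximal x s : s \in val x ->
  (forall t, t \in val x -> sep_le s t -> t = s) ->
  forall sN : s \in N, x = edge_head sN.
Proof.
move=> sx max sN; apply: node_subset_eq; apply/subsetP => t tx.
have tN := node_sub tx; rewrite inE tN /=.
have nti : t != sep_inv s.
  by apply: contraTneq tx => ->; rewrite node_inv // sx.
rewrite /sep_lt nti; case/or4P: (N_nested tN sN) => [->|st|->|st]; rewrite ?orbT //.
  by rewrite (max t tx st) sep_le_refl.
by have := node_down tx (N_inv sN) st; rewrite node_inv // sx.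
Qed.

Lemma flip_head_set s (sN : s \in N) :
  flip s (head_set s) = head_set (sep_inv s).
Proof.
have pr := N_proper sN; apply/setP => t; rewrite !inE sep_invK /sep_lt.
have [-> /=|nti /=] := eqVneq t (sep_inv s).
  by rewrite N_inv // sep_le_refl.
have [-> /=|nt /=] := eqVneq t s; first by rewrite (negPf pr) andbF.
by rewrite orbC.
Qed.

Lemma adjacent_edge_heads s (sN : s \in N) (sN' : sep_inv s \in N) :
  adjacent (edge_head sN) (edge_head sN').
Proof.
apply/exists_inP; exists s; last by rewrite /= flip_head_set.
by rewrite inE sN sep_le_refl.
Qed.

(** An edge flips just one separation, and whatever it flips is maximal in the
node that the edge leaves.  So the orientation of [s] changes across a single
edge of the tree. *)
Lemma adjacent_split x y s (sN : s \in N) (sN' : sep_inv s \in N) :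
  adjacent x y -> s \in val x -> s \notin val y ->
  x = edge_head sN /\ y = edge_head sN'.
Proof.
case/exists_inP=> t tx /eqP yE sx sy.
have ts : s = t.
  by apply: contraNeq sy => nst; rewrite yE !inE nst sx orbT.
rewrite -{}ts {t tx} in yE *.
have xE : x = edge_head sN.
  apply: node_maximal => // t tx st; apply: contraNeq sy => nts.
  apply: (node_down _ sN st); by rewrite yE !inE nts tx orbT.
by split=> //; apply: val_inj; rewrite yE xE /= flip_head_set.
Qed.

Lemma adjacentP x y :
  adjacent x y -> exists s (sN : s \in N) (sN' : sep_inv s \in N),
    x = edge_head sN /\ y = edge_head sN'.
Proof.
move=> xy; case/exists_inP: (xy) => s sx /eqP yE.
have sN := node_sub sx; have sN' := N_inv sN.
exists s, sN, sN'; apply: adjacent_split => //.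
by rewrite yE !inE eqxx (negPf (N_neq_inv sN)).
Qed.

Lemma adjacent_sym : symmetric adjacent.
Proof.
suff imp x y : adjacent x y -> adjacent y x by move=> x y; apply/idP/idP; apply: imp.
case/adjacentP=> s [sN [sN' [-> ->]]].
have sN2 := N_inv sN'.
suff -> : edge_head sN = edge_head sN2 by apply: adjacent_edge_heads.
by apply: val_inj; rewrite /= sep_invK.
Qed.

Lemma adjacent_irr : irreflexive adjacent.
Proof.
move=> x; apply/exists_inP => -[s sx /eqP E].
have := sx; rewrite E !inE eqxx /= orbF.
by rewrite (negPf (N_neq_inv (node_sub sx))).
Qed.

Lemma adjacent_enter x y s (sN : s \in N) : adjacent x y ->
  s \notin val x -> s \in val y -> y = edge_head sN /\ x = edge_head (N_inv sN).
Proof. by rewrite adjacent_sym => xy sx sy; apply: adjacent_split. Qed.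

(** A path that changes the orientation of [s] uses the edge of [s].  Of its two
ends the one not containing [s] is recorded, since this is a vertex
shared by any two such paths, in whichever direction they run. *)
Lemma path_enter x p s (sN : s \in N) : path adjacent x p ->
  s \notin val x -> s \in val (last x p) -> edge_head (N_inv sN) \in belast x p.
Proof.
elim: p x => [|y p IH] x /=; first by move=> _ /negPf->.
move=> /andP[xy yp] sx sl; rewrite inE.
have [sy|sy] := boolP (s \in val y); last by rewrite IH ?orbT.
by have [_ <-] := adjacent_enter sN xy sx sy; rewrite eqxx.
Qed.

Lemma path_leave x p s (sN : s \in N) : path adjacent x p ->
  s \in val x -> s \notin val (last x p) -> edge_head (N_inv sN) \in p.
Proof.
elim: p x => [|y p IH] x /=; first by move=> _ ->.
move=> /andP[xy yp] sx sl; rewrite inE.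
have [sy|sy] := boolP (s \in val y); first by rewrite (IH y) ?orbT.
by have [_ <-] := adjacent_split sN (N_inv sN) xy sx sy; rewrite eqxx.
Qed.

(** If the first edge [xy] of a longer cycle flips [s], the rest of the
cycle must flip [s] back, which it can only do along the same edge, and so
visits [y] a second time. *)
Lemma adjacent_acyclic (c : seq node) : ucycle adjacent c -> size c <= 2.
Proof.
case: c => [|x [|y [|z p]]] // /andP[].
rewrite [path.cycle _ _]/= => /and3P[xy yz zp] uc.
have [s [sN [sN' [xE yE]]]] := adjacentP xy.
have sx : s \in val x by rewrite xE mem_edge_head.
have sy : s \notin val y by rewrite yE notin_edge_head_inv.
have sz : s \notin val z.
  apply/negP => sz; have [zE _] := adjacent_enter sN yz sy sz.
  by move: uc; rewrite zE -xE /= !inE eqxx orbT.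
have := path_enter sN zp sz; rewrite last_rcons belast_rcons => /(_ sx).
have -> : edge_head (N_inv sN) = y by rewrite yE; apply: val_inj.
by move: uc => /= /and3P[_ /negPf->].
Qed.

Lemma flip_node x s : s \in val x ->
  (forall t, t \in val x -> sep_le s t -> t = s) ->
  exists2 y, adjacent x y & val y = flip s (val x).
Proof.
move=> sx max; have sN := node_sub sx.
have xE := node_maximal sx max sN; exists (edge_head (N_inv sN)).
  by rewrite xE; apply: adjacent_edge_heads.
by rewrite xE /= flip_head_set.
Qed.

(** A maximal element of [val x :\: val y] is maximal in [val x], because
[val y] is down-closed; flipping it brings [x] closer to [y] and leaves the
common elements alone.  With [I] empty this is connectedness of the tree; with
[I] a single separation it describes the components left by deleting its
edge. *)
Lemma connect_keeping (I : {set osep V}) x y :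
  I \subset val x -> I \subset val y ->
  connect [rel u v | [&& adjacent u v, I \subset val u & I \subset val v]] x y.
Proof.
set E := [rel u v | _]; move=> Ix Iy.
have [n] := ubnP #|val x :\: val y|; elim: n x Ix => // n IH x Ix.
have [D0 _|] := set_0Vmem (val x :\: val y).
  rewrite (_ : x = y) ?connect0 //; apply: node_subset_eq.
  by rewrite -setD_eq0 D0.
case=> s0 /maximal_exists[s sD max] lt.
have /setDP[sx sy] := sD; have sN := node_sub sx.
have maxx t : t \in val x -> sep_le s t -> t = s.
  move=> tx st; apply: max => //; rewrite inE tx andbT.
  by apply: contra sy => ty; apply: node_down ty sN st.
have [z xz zE] := flip_node sx maxx.
have Iz : I \subset val z.
  apply/subsetP => t tI; rewrite zE !inE (subsetP Ix t tI) andbT.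
  by apply/orP; right; apply: contraNneq sy => <-; apply: (subsetP Iy).
have Exz : E x z by apply/and3P.
apply: connect_trans (_ : connect E x z) _; first exact: connect1.
apply: IH => //.
rewrite -ltnS; apply: leq_trans lt; rewrite ltnS; apply: proper_card.
apply/properP; split; last first.
  exists s; rewrite // zE !inE eqxx (negPf sy) /= orbF.
  exact: N_neq_inv.
apply/subsetP => t; rewrite zE !inE => /andP[ty].
rewrite ty => /orP[/eqP tE|/andP[_ ->]//].
by move: ty; rewrite tE node_inv // sy.
Qed.

Lemma adjacent_connect x y : connect adjacent x y.
Proof.
have := connect_keeping (sub0set (val x)) (sub0set (val y)).
by apply: connect_sub => u v /and3P[uv _ _]; apply: connect1.
Qed.

Lemma connect_delete_edge s (sN : s \in N) x :
  connect (delete_edge adjacent (edge_head sN) (edge_head (N_inv sN)))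
    (edge_head sN) x
  = (s \in val x).
Proof.
have sh := mem_edge_head sN.
set D := delete_edge _ _ _; apply/idP/idP => [|sx].
  have cl : closed D [pred u : node | s \in val u].
    move=> u v /andP[uv ne]; rewrite !inE.
    apply/idP/idP => h; apply: contraR ne => h'; apply/eqP.
      by have [-> ->] := adjacent_split sN (N_inv sN) uv h h'.
    by have [-> ->] := adjacent_enter sN uv h' h; rewrite setUC.
  by move/(closed_connect cl); rewrite !inE sN sep_le_refl /= => <-.
have := @connect_keeping [set s] (edge_head sN) x; rewrite !sub1set => /(_ sh sx).
apply: connect_sub => u v; rewrite /= !sub1set => /and3P[uv su sv].
apply: connect1; apply/andP; split=> //; apply: contraTneq su => E.
have : edge_head (N_inv sN) \in [set u; v] by rewrite E !inE eqxx orbT.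
have nh := notin_edge_head_inv sN (N_inv sN).
rewrite !inE => /orP[/eqP<-//|/eqP vE].
by rewrite -vE (negPf nh) in sv.
Qed.

Lemma part_sub x s : s \in val x -> part x \subset s.2.
Proof. by move=> sx; apply: bigcap_inf. Qed.

(** Starting from [x], flip the separations whose second side does not contain
[K], maximal ones first; each flip makes the number of these drop, and
separations already pointing to [K] are left alone. *)
Lemma part_exists K x :
  (forall s, s \in N -> (K \subset s.1) || (K \subset s.2)) ->
  exists2 y, K \subset part y &
    forall s, s \in val x -> K \subset s.2 -> s \in val y.
Proof.
move=> side; pose bad x := [set s in val x | ~~ (K \subset s.2)].
have [n] := ubnP #|bad x|; elim: n x => // n IH x lt.
have [D0|] := set_0Vmem (bad x).
  exists x => //; apply/bigcapsP => s sx; apply: contraT => sK.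
  by have := in_set0 s; rewrite -D0 inE sx sK.
case=> s0 /maximal_exists[s]; rewrite inE => /andP[sx sK] max.
have sN := node_sub sx.
have maxx t : t \in val x -> sep_le s t -> t = s.
  move=> tx st; apply: max => //; rewrite inE tx /=.
  by apply: contra sK => tK; apply: subset_trans tK _; case/andP: st.
have [z xz zE] := flip_node sx maxx.
have isK : K \subset (sep_inv s).2 by case/orP: (side s sN); rewrite ?(negPf sK).
have [|y Ky yP] := IH z.
  rewrite -ltnS; apply: leq_trans lt; rewrite ltnS; apply: proper_card.
  apply/properP; split; last first.
    exists s; first by rewrite inE sx.
    by rewrite inE zE !inE eqxx /= orbF (negPf (N_neq_inv sN)).
  apply/subsetP => t; rewrite !inE zE !inE => /andP[/orP[/eqP->|/andP[_ ->]//]].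
  by rewrite isK.
exists y => // t tx tK; apply: yP => //; rewrite zE !inE tx andbT.
by apply/orP; right; apply: contraNneq sK => <-.
Qed.

Lemma node_exists : 0 < #|node|.
Proof.
apply/card_gt0P; have [N0|[s sN]] := set_0Vmem N; last by exists (edge_head sN).
have h : is_node set0.
  apply/and3P; split; first exact: sub0set.
    by apply/forall_inP => s; rewrite N0 inE.
  by apply/forall_inP => s; rewrite inE.
by exists (Sub set0 h).
Qed.

Lemma part_exists_node K :
  (forall s, s \in N -> (K \subset s.1) || (K \subset s.2)) ->
  exists x, K \subset part x.
Proof.
have /card_gt0P[x0 _] := node_exists.
by case/(part_exists x0) => x Kx _; exists x.
Qed.

(** An element [s] of [u] that belongs to neither end of the path would have
to be flipped both before and after [u], so that the path would use the edge of
[s] twice. *)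
Lemma part_path x p u : path adjacent x p -> uniq (x :: p) -> u \in x :: p ->
  part x :&: part (last x p) \subset part u.
Proof.
move=> xp up ux; case/splitPl: ux xp up => p1 p2 <- {u}.
rewrite cat_path last_cat -cat_cons cat_uniq => /andP[xp1 up2].
case/and3P=> _ /hasPn disj _; apply/bigcapsP => s su.
have [sx|sx] := boolP (s \in val x).
  exact: subset_trans (subsetIl _ _) (part_sub sx).
have [sl|sl] := boolP (s \in val (last (last x p1) p2)).
  exact: subset_trans (subsetIr _ _) (part_sub sl).
have sN := node_sub su; have h2 := path_leave sN up2 su sl.
by have /negP[] := disj _ h2; apply/mem_belast/path_enter.
Qed.

Hypothesis N_cover : forall s, s \in N -> s.1 :|: s.2 = setT.

(** That every vertex of [s.2] lies in the part of a node containing [s] is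
[part_exists], applied to this vertex and started at the node to which [s]
points. *)
Lemma cup_parts s : s \in N -> \bigcup_(x : node | s \in val x) part x = s.2.
Proof.
move=> sN; apply/setP => v; apply/bigcupP/idP => [[x sx]|vs].
  exact/subsetP/part_sub.
have [t tN|y vy yP] := @part_exists [set v] (edge_head sN).
  by rewrite !sub1set; have /setP/(_ v) := N_cover tN; rewrite !inE.
by exists y; [apply: yP; rewrite ?mem_edge_head ?sub1set | rewrite -sub1set].
Qed.

(** Deleting the edge leaves the nodes containing [s] on one side and those
containing its inverse on the other. *)
Lemma edge_sep_head s (sN : s \in N) :
  edge_sep adjacent part (edge_head sN) (edge_head (N_inv sN)) = sep_inv s.
Proof.
congr pair.
  rewrite -(cup_parts sN); apply: eq_bigl => x; exact: connect_delete_edge.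
rewrite -[RHS](cup_parts (N_inv sN)); apply: eq_bigl => x.
have <- := connect_delete_edge (N_inv sN) x.
have -> : edge_head (N_inv (N_inv sN)) = edge_head sN.
  by apply: val_inj; rewrite /= sep_invK.
by apply: eq_connect => u v; congr (_ && (_ != _)); exact: setUC.
Qed.

Lemma adjacent_tree : is_tree adjacent.
Proof.
split; [exact: adjacent_sym | exact: adjacent_irr | exact: node_exists |
  exact: adjacent_connect | exact: adjacent_acyclic].
Qed.

End Tree.

(** * The action of the automorphism group on the tree *)
Section Canonical.
Variables (V : finType) (e : rel V) (N : {set osep V}).
Implicit Types (r s t : osep V) (O : {set osep V}) (a b : {perm V}).
Hypothesis N_map : forall a s, a \in graph_aut e -> s \in N -> sep_map a s \in N.

Local Notation node := (node N).
Implicit Types x y : node.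

Lemma mem_N_map a s : a \in graph_aut e -> (sep_map a s \in N) = (s \in N).
Proof.
move=> aut; apply/idP/idP => [|]; last exact: N_map.
by move/(N_map (graph_autV aut)); rewrite sep_mapK.
Qed.

Lemma is_node_map a O : a \in graph_aut e -> is_node N O ->
  is_node N (sep_map a @: O).
Proof.
move=> aut /and3P[/subsetP sub /forall_inP or /forall_inP down].
apply/and3P; split.
- apply/subsetP => s; have [t ->] := sep_mapP a s.
  by rewrite mem_sep_map mem_N_map //; apply: sub.
- apply/forall_inP => s; have [t ->] := sep_mapP a s.
  by rewrite mem_N_map // -sep_map_inv !mem_sep_map; apply: or.
apply/forall_inP => s; have [s' ->] := sep_mapP a s; rewrite mem_sep_map.
move=> /down/forall_inP h; apply/forall_inP => t; have [t' ->] := sep_mapP a t.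
by rewrite mem_N_map // sep_map_le mem_sep_map; apply: h.
Qed.

(** An action is required to be injective for every permutation, hence the
default value outside the automorphism group. *)
Definition node_act x a : node :=
  if a \in graph_aut e then insubd x (sep_map a @: val x) else x.

Lemma val_node_act x a : a \in graph_aut e ->
  val (node_act x a) = sep_map a @: val x.
Proof.
by move=> aut; rewrite /node_act aut val_insubd is_node_map // (valP x).
Qed.

Lemma node_act_is_action : is_action (graph_aut e) node_act.
Proof.
split=> [a x y|x a b aa bb].
  have [aut|aut] := boolP (a \in graph_aut e); last first.
    by rewrite /node_act (negPf aut).
  move/(congr1 val); rewrite !val_node_act // => /imset_inj E.
  by apply/val_inj/E/sep_map_inj.
have ab : (a * b)%g \in graph_aut e.
  move: aa bb; rewrite !inE => /'forall_forallP ha /'forall_forallP hb.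
  by apply/'forall_forallP => u v; rewrite !permM (eqP (hb _ _)).
apply: val_inj; rewrite !val_node_act // -imset_comp.
by apply: eq_imset => s; rewrite sep_mapM.
Qed.

Lemma adjacent_act x y a : a \in graph_aut e ->
  adjacent (node_act x a) (node_act y a) = adjacent x y.
Proof.
move=> aut.
have flip_map s O : flip (sep_map a s) (sep_map a @: O) = sep_map a @: flip s O.
  apply/setP => t; have [u ->] := sep_mapP a t.
  by rewrite mem_sep_map !inE mem_sep_map -sep_map_inv !(inj_eq (@sep_map_inj _ a)).
have inj := imset_inj (@sep_map_inj _ a).
apply/exists_inP/exists_inP => [[s]|[s sx yE]].
  have [t ->] := sep_mapP a s.
  rewrite !val_node_act // mem_sep_map flip_map (inj_eq inj) => tx yE.
  by exists t.
exists (sep_map a s); rewrite !val_node_act // ?mem_sep_map //.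
by rewrite flip_map (inj_eq inj).
Qed.

Lemma part_act x a : a \in graph_aut e -> a @: part x = part (node_act x a).
Proof.
move=> aut; apply/setP => v; rewrite -(permKV a v) mem_imset; last exact: perm_inj.
apply/bigcapP/bigcapP => h s; last first.
  move=> sx; have := h (sep_map a s); rewrite val_node_act // mem_sep_map.
  by move/(_ sx); rewrite mem_imset //; apply: perm_inj.
rewrite val_node_act //; have [t ->] := sep_mapP a s; rewrite mem_sep_map => /h.
by rewrite mem_imset //; apply: perm_inj.
Qed.

Lemma adjacent_canonical : is_canonical e (@adjacent V N) (@part V N).
Proof.
exists (Action node_act_is_action) => a aut.
by split=> [x y|x]; [exact: adjacent_act | exact: part_act].
Qed.

End Canonical.

(** * The tree-decomposition *)
Section TreeDecomposition.
Variables (V : finType) (e : rel V) (N : {set osep V}).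
Hypothesis e_sym : symmetric e.
Hypothesis N_inv : forall s, s \in N -> sep_inv s \in N.
Hypothesis N_nested : forall r s, r \in N -> s \in N -> nested r s.
Hypothesis N_proper : forall s, s \in N -> ~~ sep_le s (sep_inv s).
Hypothesis N_sep : forall s, s \in N -> is_sep e s.

Lemma part_decomposition :
  is_tree_decomposition e (@adjacent V N) (@part V N).
Proof.
split; first exact: adjacent_tree.
- apply/setP => v; rewrite inE; apply/bigcupP.
  have [s sN|x vx] := part_exists_node N_inv N_nested N_proper (K := [set v]).
    by rewrite !sub1set; apply: sep_cover (N_sep sN).
  by exists x => //; rewrite -sub1set.
- move=> v w evw.
  have [s sN|x] := part_exists_node N_inv N_nested N_proper (K := [set v; w]).
    by rewrite !subUset !sub1set; apply: sep_edge (N_sep sN) evw.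
  by rewrite subUset !sub1set => /andP[vx wx]; exists x.
by move=> x p u; apply: part_path.
Qed.

Lemma decomposition_edge s : s \in N ->
  exists x y, adjacent x y /\ edge_sep (@adjacent V N) (@part V N) x y = s.
Proof.
move=> sN; have sN' := N_inv sN.
have cover t : t \in N -> t.1 :|: t.2 = setT by move/N_sep/andP=> [/eqP].
exists (edge_head N_inv N_nested N_proper sN').
exists (edge_head N_inv N_nested N_proper (N_inv sN')).
by split; [exact: adjacent_edge_heads | rewrite edge_sep_head ?sep_invK].
Qed.

End TreeDecomposition.

Theorem theorem3 (V : finType) (e : rel V)
    (e_sym : symmetric e) (e_irr : irreflexive e) :
  exists (T : finType) (f : rel T) (W : T -> {set V}),
    [/\ is_tree_decomposition e f W,
        is_canonical e f W &
        forall P P' : {set osep V},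
          tangle_or_robust_block e P -> tangle_or_robust_block e P' ->
          distinguishable e P P' ->
          exists t1 t2 : T,
            f t1 t2 /\
            efficiently_distinguishes e (edge_sep f W t1 t2) P P'].
Proof.
pose N := tree_set e #|V|.+1.
have N_inv s : s \in N -> sep_inv s \in N by apply: tree_set_inv.
have N_nested r s : r \in N -> s \in N -> nested r s by apply: tree_set_nested.
have N_proper s : s \in N -> ~~ sep_le s (sep_inv s) by apply: tree_set_proper.
have N_sep s : s \in N -> is_sep e s by apply: tree_set_is_sep.
exists (node N), (@adjacent V N), (@part V N); split.
- exact: part_decomposition.
- by apply: adjacent_canonical => a s; apply: tree_set_map.
move=> P P' /(tangle_or_robust_block_regular e_sym) rP.
move=> /(tangle_or_robust_block_regular e_sym) rP' PP'.
have [s sN es] := tree_set_distinguishes e_sym rP rP' PP'.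
have [x [y [xy xyE]]] := decomposition_edge N_inv N_nested N_proper N_sep sN.
by exists x, y; rewrite xyE.
Qed.
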